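(* Let $\mathcal{P} = \langle P, \leq \rangle$ be a Borel quasi order such that $|P / E_{\leq}| > 1$. Then $\mathrm{odim}_B(\mathcal{P}) = \vec{\chi}^{w}_{B}(\langle \mathcal{A}_{\mathcal{P}}, \mathcal{R}_{\mathcal{P}} \rangle)$.
   Context: A quasi order on a set $P$ is a reflexive transitive relation $\leq$ on $P$; $\langle P,\leq\rangle$ is then called a quasi order. A partial order is an irreflexive transitive relation. For a quasi order $\leq$ on $P$: $x \, E_{\leq} \, y$ iff ($x \leq y$ and $y \leq x$), an equivalence relation; $x<y$ iff ($x\leq y$ and $y \nleq x$); the relation $<$ induces a partial order on $P/E_{\leq}$, also denoted $<$, by $[x]<[y]$ iff $x<y$. A quasi order $\langle P,\leq\rangle$ is Borel if $P$ is a Polish space and $\leq$ is a Borel subset of $P\times P$. A partial order $<'$ on a set $Q$ extends a partial order $<$ on $Q$ if $<\ \subseteq\ <'$. Borel order dimension: let $\mathcal{P}=\langle P,\leq\rangle$ be a Borel quasi order. A partial order $\prec$ on $P/E_{\leq}$ is Borel if there is a Borel quasi order $\preceq$ on $P$ with $E_{\preceq}=E_{\leq}$ such that $\prec$ is the partial order on $P/E_{\preceq}=P/E_{\leq}$ induced by $\preceq$. $\mathrm{odim}_B(\mathcal{P})$ is the minimal cardinal $\kappa$ such that there is a sequence $\langle <_i : i\in\kappa\rangle$ of Borel partial orders on $P/E_{\leq}$ extending $<$ such that for all $x,y\in P$ there is $i\in\kappa$ with ($[y]<_i[x]$ or $[x]<[y]$ or $[x]=[y]$). Digraphs: a digraph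 is a pair $\langle X,R\rangle$ with $R\subseteq X\times X$ and $\langle x,x\rangle\notin R$ for all $x\in X$. It is Borel (analytic) if $X$ is Polish and $R$ is a Borel (analytic) subset of $X \times X$. For $Y\subseteq X$, an $R$-cycle in $Y$ is a finite non-empty sequence $\langle y_0,\dots,y_k\rangle$ of elements of $Y$ with $y_i R y_{i+1}$ for all $i<k$ and $y_k R y_0$. For an analytic digraph $\langle X,R\rangle$, the weak Borel dichromatic number $\vec{\chi}^{w}_{B}(\langle X,R\rangle)$ is the minimal cardinal $\kappa$ such that $X=\bigcup_{\alpha<\kappa}X_\alpha$ for some Borel sets $X_\alpha \subseteq X$ none of which contains an $R$-cycle. For a quasi order $\mathcal{P}=\langle P,\leq\rangle$, $\mathcal{A}_{\mathcal{P}}=\{\langle x,y\rangle\in P\times P: y\nleq x\}$, and for $\langle x_0,y_0\rangle,\langle x_1,y_1\rangle\in\mathcal{A}_{\mathcal{P}}$, $\langle x_0,y_0\rangle\,\mathcal{R}_{\mathcal{P}}\,\langle x_1,y_1\rangle$ iff $y_0\leq x_1$. If $\mathcal{P}$ is Borel, then $\mathcal{A}_{\mathcal{P}}$ is a Borel subset of $P\times P$ (given any Polish topology refining the subspace topology, which has the same Borel sets), and $\langle\mathcal{A}_{\mathcal{P}},\mathcal{R}_{\mathcal{P}}\rangle$ is a Borel digraph. *)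

(* Defs.v *)
From Corelib Require Import RelationClasses.
From mathcomp Require Import all_boot all_order all_algebra.
From mathcomp Require Import all_classical all_reals all_analysis.

Set Implicit Arguments.
Unset Strict Implicit.
Unset Printing Implicit Defensive.

Import Order.TTheory GRing.Theory Num.Theory.
Local Open Scope classical_set_scope.
Local Open Scope card_scope.
Local Open Scope ring_scope.

Definition borel_set (T : topologicalType) : set (set T) := <<s open >>.

(* Separable and completely metrizable; the metric is not part of the data. *)
Definition polish_space (R : realType) (T : topologicalType) : Prop :=
  (exists2 D : set T, countable D & dense D) /\
  exists d : T -> T -> R,
    [/\ forall x y, d x y = 0 <-> x = y,
        forall x y, d x y = d y x,
        forall x y z, d x z <= d x y + d y z,
        forall (x : T) (U : set T),
          nbhs x U <-> exists2 e : R, 0 < e & [set y | d x y < e] `<=` U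
      & forall u : nat -> T,
          (forall e : R, 0 < e ->
             exists N, forall m n, (N <= m)%N -> (N <= n)%N ->
               d (u m) (u n) < e) ->
          exists x : T, u @ \oo --> x].

(* A cardinal is represented by any type of that cardinality: [K] represents
   the minimal cardinal satisfying [Q]. *)
Definition is_min_cardinal (Q : Type -> Prop) (K : Type) : Prop :=
  Q K /\ forall J : Type, Q J -> [set: K] #<= [set: J].

Section QuasiOrder.
Context {P : Type} (le : P -> P -> Prop).

Definition qequiv (x y : P) : Prop := le x y /\ le y x.

Definition qlt (x y : P) : Prop := le x y /\ ~ le y x.

Definition qclass (x : P) : set P := [set y | qequiv x y].

Definition quot : Type := set_type (range qclass).

Definition cls (x : P) : quot := SigSub (mem_set (imageT qclass x)).

Definition quot_lt (c d : quot) : Prop :=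
  exists x y : P, [/\ c = cls x, d = cls y & qlt x y].

End QuasiOrder.

Section BorelOrderDimension.
Context {P : topologicalType}.

(* To be used on a Polish space [P]. *)
Definition borel_quasi_order (le : P -> P -> Prop) : Prop :=
  PreOrder le /\ borel_set [set p : P * P | le p.1 p.2].

(* [StrictOrder] is irreflexivity and transitivity. *)
Definition borel_partial_order (le : P -> P -> Prop)
    (prec : quot le -> quot le -> Prop) : Prop :=
  StrictOrder prec /\
  exists ple : P -> P -> Prop,
    [/\ borel_quasi_order ple,
        forall x y, qequiv ple x y <-> qequiv le x y
      & forall x y, prec (cls le x) (cls le y) <-> qlt ple x y].

Definition borel_realizer (le : P -> P -> Prop) (K : Type) : Prop :=
  exists lt : K -> quot le -> quot le -> Prop,
    [/\ forall i, borel_partial_order (lt i),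
        forall i c d, quot_lt c d -> lt i c d
      & forall x y : P, exists i : K,
          [\/ lt i (cls le y) (cls le x),
              quot_lt (cls le x) (cls le y)
            | cls le x = cls le y]].

Definition is_odimB (le : P -> P -> Prop) : Type -> Prop :=
  is_min_cardinal (borel_realizer le).

End BorelOrderDimension.

Record digraph (X : Type) := Digraph {
  arc :> X -> X -> Prop;
  arc_irrefl : forall x, ~ arc x x
}.

Section Dichromatic.
Context {X : topologicalType} (G : digraph X).

Definition has_cycle (Y : set X) : Prop :=
  exists (k : nat) (y : nat -> X),
    [/\ forall i, (i <= k)%N -> Y (y i),
        forall i, (i < k)%N -> G (y i) (y i.+1)
      & G (y k) (y 0%N)].

Definition borel_dicoloring (K : Type) : Prop :=
  exists F : K -> set X,
    [/\ forall i, borel_set (F i),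
        \bigcup_i F i = setT
      & forall i, ~ has_cycle (F i)].

Definition is_weak_borel_dichromatic : Type -> Prop :=
  is_min_cardinal borel_dicoloring.

End Dichromatic.

Section Incomparability.
Context {P : topologicalType} (le : P -> P -> Prop).

(* As a type, [not_ge] carries the subspace topology of [P * P].  This topology
   need not be Polish, but only its Borel sets matter, and they are those of any
   finer Polish topology. *)
Definition not_ge : set (P * P) := [set p | ~ le p.2 p.1].

Definition not_ge_arc (a b : not_ge) : Prop :=
  le (set_val a).2 (set_val b).1.

Lemma not_ge_arc_irrefl (a : not_ge) : ~ not_ge_arc a a.
Proof. exact: (set_valP a). Qed.

Definition not_ge_digraph : digraph not_ge := Digraph not_ge_arc_irrefl.

End Incomparability.

(* Main.v *)
Require Import Defs.
From Corelib Require Import RelationClasses.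
From mathcomp Require Import all_boot all_order all_algebra.
From mathcomp Require Import all_classical all_reals all_analysis.
From mathcomp Require Import ring lra.

Set Implicit Arguments.
Unset Strict Implicit.
Unset Printing Implicit Defensive.

Import Order.TTheory GRing.Theory Num.Theory.
Local Open Scope classical_set_scope.
Local Open Scope card_scope.
Local Open Scope ring_scope.

(** A Borel realizer of size K and a Borel dicoloring of size K are obtained
    from each other without changing the index type, so the two minimal
    cardinals coincide.

    From a realizer (<_i) one colours a pair (x, y) with y not below x by an i
    such that [x] <_i [y].  Along a cycle of one colour every pair makes a
    strict step of <_i and every arc a step of <=, which <_i extends; the cycle
    would make <_i reflexive somewhere ([realizer_dicoloring]).

    Conversely, let F be one Borel colour class without cycles.  The quasi order
    S generated by <= and F has the same equivalence classes as <=, because a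
    nontrivial loop in S is a cycle in F ([chain_antisym]); but S is in general
    only analytic.  It remains to enlarge S to a Borel quasi order with the same
    classes ([analytic_quasi_order_borel_extension]).  Lusin separation gives a
    Borel relation B containing S whose symmetric part is contained in that of
    <=.  Transitivity is then recovered by interpolation: by two more
    separations, there is a Borel B' with S <= B' <= B and B' o B' <= B
    ([borel_transitive_interpolation]), so that iterating B, B', B'', ... and
    intersecting yields a Borel relation which is transitive, since its square
    is included in each term of the sequence.

    Separation requires the basic theory of analytic sets: these are taken to be
    the projections of closed subsets of T x Baire, every nonempty Polish space
    is a continuous image of the Baire space ([polish_baire_image]), and disjoint
    analytic sets are separated by a bar induction on sequences of pairs of
    integers ([lusin_separation]).

    Finally the singletons form a dicoloring, so some cardinal works, and among
    any family of types there is one that embeds in all the others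
    ([least_type]); hence the minimum exists. *)

(** * Minimal cardinals *)

(** Cardinals are well-ordered, in the form of a single use of Zorn's lemma:
    take a maximal set of elements of the product of the [X i] any two of which
    differ at every coordinate.  By maximality it projects onto some [X i], and
    then its other projections, read from [X i], are injective. *)
Lemma least_type (I : Type) (i0 : I) (X : I -> Type) :
  exists i, forall j, exists f : X i -> X j, injective f.
Proof.
pose apart (A : set (forall i, X i)) :=
  forall s t, A s -> A t -> forall i, s i = t i -> s = t.
have [A [apartA maxA]] : exists A, apart A /\ forall B, A `<` B -> ~ apart B.
  apply: Zorn_bigcup => F apartF totF s t [A FA As] [B FB Bt] i.
  have [AB|BA] := totF _ _ FA FB.
    by apply: (apartF B FB) => //; exact: AB.
  by apply: (apartF A FA) => //; exact: BA.
have [i onto] : exists i, forall x : X i, exists2 s, A s & s i = x.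
  apply: contrapT => noti.
  have miss i : exists x : X i, forall s, A s -> s i <> x.
    apply: contrapT => nomiss; apply: noti; exists i => x.
    apply: contrapT => nos; apply: nomiss; exists x => s As sx.
    by apply: nos; exists s.
  (* If every projection misses a point, these points form one more element. *)
  pose u i : X i := projT1 (cid (miss i)).
  have uP i s : A s -> s i <> u i by exact: (projT2 (cid (miss i))).
  apply: (maxA (A `|` [set u])).
    split=> [s As|sub]; first by left.
    have Au : A u by apply: sub; right.
    exact: (uP i0 u Au).
  move=> s t [As|->] [At|->] i // => [|/uP|/esym/uP]; last 2 first.
  - by move=> /(_ As).
  - by move=> /(_ At).
  exact: apartA.
have [g gP] : {g : X i -> forall j, X j & forall x, A (g x) /\ g x i = x}.
  by apply: (@choice _ _ (fun x s => A s /\ s i = x)) => x; have [s] := onto x; exists s.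
exists i => j; exists (fun x => g x j) => x y /(apartA _ _ (gP x).1 (gP y).1).
by move=> gxy; rewrite -(gP x).2 -(gP y).2 gxy.
Qed.

Lemma card_le_inj (T U : Type) (f : T -> U) :
  injective f -> [set: T] #<= [set: U].
Proof.
move=> injf; suff: $|{injfun [set: T] >-> [set: U]}| by case=> g; exact: inj_card_le g.
by apply/injfunPex; exists f => // x y _ _; exact: injf.
Qed.

(** The candidates may be restricted to the subsets of [K0], which are indexed
    by a type: a solution [J] either receives an injection from the least subset
    or embeds in it, and then it is in bijection with a subset of [K0]. *)
Lemma min_cardinal_exists (Q : Type -> Prop) (K0 : Type) :
  (forall (J K : Type) (f : J -> K) (g : K -> J),
     cancel f g -> cancel g f -> Q J -> Q K) ->
  Q K0 -> exists K, is_min_cardinal Q K.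
Proof.
move=> Qbij QK0.
have QT : Q (set_type [set: K0]).
  apply: (Qbij K0 _ (fun x => SigSub (mem_set (I : [set: K0] x))) set_val) => //.
  by move=> x; apply: val_inj.
pose I := {A : set K0 | Q (set_type A)}.
have [[A QA] minA] := @least_type I (exist _ setT QT) (fun A => set_type (sval A)).
exists (set_type A); split=> // J QJ.
have [[] inj] := @least_type bool true (fun b => if b then set_type A else J).
  by have [f /card_le_inj] := inj false.
have [f injf] := inj true.
pose B := range (set_val \o f).
pose h (x : J) : set_type B := SigSub (mem_set (imageT (set_val \o f) x)).
have [k kP] : {k : set_type B -> J & forall b, set_val (f (k b)) = set_val b}.
  apply: (@choice _ _ (fun b x => set_val (f x) = set_val b)) => b.
  by have [x _ xb] := set_valP b; exists x.
have hk : cancel k h by move=> b; apply: val_inj; rewrite /= -set_valE kP.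
have kh : cancel h k.
  by move=> x; apply: injf; apply: val_inj; rewrite -!set_valE kP set_valE.
have QB : Q (set_type B) by exact: (Qbij _ _ _ _ kh hk).
have [g injg] := minA (exist _ B QB).
apply: (@card_le_inj _ _ (k \o g)) => x y /(can_inj hk); exact: injg.
Qed.

(** * The Baire space and analytic sets *)

Definition baire := {ptws nat -> nat}.

Definition cyl (n : nat) (s : baire) : set baire :=
  [set t | forall k, (k < n)%N -> t k = s k].

Lemma cyl_nbhs n s : nbhs s (cyl n s).
Proof.
elim: n => [|n IHn]; first by apply: filterS filterT => t _ k.
have /filterI : nbhs s (@proj nat (fun=> nat) n @^-1` [set s n]).
  exact: (@proj_continuous nat (fun=> nat) n s).
move=> /(_ _ IHn); apply: filterS => t [/= tn ts] k.
by rewrite ltnS leq_eqVlt => /orP[/eqP->|/ts].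
Qed.

(** The sets containing a cylinder around [s] form a filter that converges to
    [s] coordinatewise, hence in the product topology. *)
Lemma nbhs_cyl s (U : set baire) : nbhs s U -> exists n, cyl n s `<=` U.
Proof.
pose F : set_system baire := [set V | exists n, cyl n s `<=` V].
have FF : Filter F.
  split=> [|V W [n nV] [m mW]|V W VW [n nV]]; first by exists 0%N.
    exists (maxn n m) => t ts; split.
      by apply: nV => k kn; apply: ts; rewrite leq_max kn.
    by apply: mW => k km; apply: ts; rewrite leq_max km orbT.
  by exists n; exact: subset_trans VW.
suff Fs : F --> s by move=> /Fs.
apply/cvg_sup => i V [_ [[W _ <-] /= Wsi WV]].
by exists i.+1 => t /(_ i (leqnn _)) ti; apply: WV => /=; rewrite ti.
Qed.

Lemma reindex_continuous (u : nat -> nat) :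
  continuous (fun s : baire => (fun k => s (u k)) : baire).
Proof.
move=> s U /nbhs_cyl[n nU].
have := cyl_nbhs (\max_(k < n) (u k).+1) s; apply: filterS => t ts.
apply: nU => k kn; apply: ts.
exact: (@leq_bigmax _ (fun k : 'I_n => (u k).+1) (Ordinal kn)).
Qed.

(** Through a coding of pairs of integers, one point of the Baire space carries
    a sequence of points, which can be arbitrary ([slice_surj]) and depends on it
    continuously. *)
Definition slice (n : nat) (s : baire) : baire := fun k => s (pickle (n, k)).

Lemma slice_continuous n : continuous (slice n).
Proof. exact: reindex_continuous. Qed.

Lemma slice_surj (s_ : nat -> baire) : exists s, forall n, slice n s = s_ n.
Proof.
exists (fun m => if unpickle m is Some (n, k) then s_ n k else 0%N) => n.
by apply/funext => k; rewrite /slice pickleK.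
Qed.

Lemma pair_continuous (S T U : topologicalType) (f : S -> T) (g : S -> U) :
  continuous f -> continuous g -> continuous (fun x => (f x, g x)).
Proof. by move=> cf cg x; apply: cvg_pair; [exact: cf|exact: cg]. Qed.

Lemma comp_continuous (S T U : topologicalType) (f : S -> T) (g : T -> U) :
  continuous f -> continuous g -> continuous (g \o f).
Proof. by move=> cf cg x; apply: continuous_comp; [exact: cf|exact: cg]. Qed.

Lemma fst_continuous (S T : topologicalType) : continuous (@fst S T).
Proof. by move=> x; exact: cvg_fst. Qed.

Lemma snd_continuous (S T : topologicalType) : continuous (@snd S T).
Proof. by move=> x; exact: cvg_snd. Qed.

Lemma closed_preimage (S T : topologicalType) (f : S -> T) (D : set T) :
  continuous f -> closed D -> closed (f @^-1` D).
Proof. by move=> cf; apply: preimage_closed => x _; exact: cf. Qed.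

(** As projections of closed sets, rather than continuous images of the Baire
    space, analytic sets need no special case for the empty set, and their
    preimages and countable unions and intersections amount to substitutions in
    the closed set. *)
Definition analytic (T : topologicalType) : set (set T) :=
  [set A | exists2 D : set (T * baire), closed D & A = fst @` D].

Section AnalyticClosure.
Context {T : topologicalType}.
Implicit Types A B : set T.

Lemma analyticP A (D : set (T * baire)) : closed D ->
  (forall x, A x <-> exists s, D (x, s)) -> analytic A.
Proof.
move=> cD AD; exists D => //; apply/seteqP; split=> [x /AD[s Ds]|_ [[x s] Ds <-]].
  by exists (x, s).
by apply/AD; exists s.
Qed.

Lemma analytic_choice (A : nat -> set T) : (forall n, analytic (A n)) ->
  {D : nat -> set (T * baire) & forall n, closed (D n) /\ A n = fst @` D n}.
Proof.
move=> aA; apply: (@choice _ _ (fun n D => closed D /\ A n = fst @` D)) => n.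
by have [D] := aA n; exists D.
Qed.

Lemma closed_analytic A : closed A -> analytic A.
Proof.
move=> cA; apply: (@analyticP _ (fst @^-1` A)).
  by apply: closed_preimage cA; exact: fst_continuous.
by move=> x; split=> [Ax|[]//]; exists (fun=> 0%N).
Qed.

(** A single witness codes, in its slices, witnesses for all the sets. *)
Lemma analytic_bigcap (A : nat -> set T) :
  (forall n, analytic (A n)) -> analytic (\bigcap_n A n).
Proof.
move=> /analytic_choice[D DP].
pose g n (z : T * baire) := (z.1, slice n z.2).
apply: (@analyticP _ (\bigcap_n g n @^-1` D n)).
  apply: closed_bigI => n _; apply: closed_preimage (DP n).1.
  by apply: pair_continuous; [exact: fst_continuous | apply: comp_continuous;
    [exact: snd_continuous | exact: slice_continuous]].
move=> x; split=> [Ax|[s Ds] n _]; last first.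
  by rewrite (DP n).2; exists (x, slice n s); first exact: (Ds n).
have [s_ sP] : {s_ : nat -> baire & forall n, D n (x, s_ n)}.
  apply: (@choice _ _ (fun n s => D n (x, s))) => n.
  by have := Ax n I; rewrite (DP n).2 => -[[y s] Ds <-]; exists s.
have [s ss] := slice_surj s_; exists s => n _.
by rewrite /g /= ss.
Qed.

(** The first term of the witness selects the set, the remaining ones witness
    membership in it. *)
Lemma analytic_bigcup (A : nat -> set T) :
  (forall n, analytic (A n)) -> analytic (\bigcup_n A n).
Proof.
move=> /analytic_choice[D DP].
pose g (z : T * baire) : T * baire := (z.1, (fun k => z.2 k.+1) : baire).
pose h (z : T * baire) : nat := z.2 0%N.
(* The union over [n] of the pieces [h = n] is closed as it is also the
   intersection over [n] of the conditions [h = n -> ...]. *)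
apply: (@analyticP _ (\bigcap_n (h @^-1` (~` [set n]) `|` g @^-1` D n))).
  apply: closed_bigI => n _; apply: closedU.
    apply: closed_preimage; last by rewrite closedC; exact: discrete_open.
    have c0 := @proj_continuous nat (fun=> nat) 0%N.
    exact: (comp_continuous (@snd_continuous T baire) c0).
  apply: closed_preimage (DP n).1.
  apply: pair_continuous; first exact: fst_continuous.
  have cS := @reindex_continuous S.
  exact: (comp_continuous (@snd_continuous T baire) cS).
move=> x; split=> [[n _]|[s Ds]]; last first.
  exists (s 0%N) => //; rewrite (DP _).2.
  by have [/=|Dg] := Ds (s 0%N) I; [move=> /(_ erefl) | exists (g (x, s))].
rewrite (DP n).2 => -[[y s] Ds <-].
exists ((fun k => if k is k.+1 then s k else n) : baire) => m _ /=.
by have [<-|mn] := pselect (n = m); [right|left].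
Qed.

Lemma analyticI A B : analytic A -> analytic B -> analytic (A `&` B).
Proof.
move=> aA aB; rewrite -bigcap2E; apply: analytic_bigcap => -[|[|n]] //=.
by apply: closed_analytic; exact: closedT.
Qed.

End AnalyticClosure.

Lemma analytic_preimage (S T : topologicalType) (f : S -> T) (A : set T) :
  continuous f -> analytic A -> analytic (f @^-1` A).
Proof.
move=> cf [D cD ->].
apply: (@analyticP _ _ ((fun z : S * baire => (f z.1, z.2)) @^-1` D)).
  apply: closed_preimage cD; apply: pair_continuous; last exact: snd_continuous.
  by apply: comp_continuous => //; exact: fst_continuous.
move=> x; split=> [[[y s] Ds /= yE]|[s Ds]]; first by exists s; rewrite /= -yE.
by exists (f x, s).
Qed.

Definition baire_image (T : topologicalType) : Prop :=
  exists2 p : baire -> T, continuous p & forall x, exists s, p s = x.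

Lemma baire_imageX (S T : topologicalType) :
  baire_image S -> baire_image T -> baire_image (S * T)%type.
Proof.
move=> [p cp pS] [q cq qT]; exists (fun s => (p (slice 0 s), q (slice 1 s))).
  apply: pair_continuous; apply: comp_continuous => //; exact: slice_continuous.
move=> [x y]; have [s <-] := pS x; have [t <-] := qT y.
by have [r rE] := slice_surj (fun n => if n is 0%N then s else t); exists r; rewrite !rE.
Qed.

(** A witness for the projection codes a witness for [A] together with a point
    of the Baire space above the coordinate that is forgotten. *)
Lemma analytic_proj (S T : topologicalType) (A : set (S * T)) :
  baire_image S -> analytic A -> analytic (snd @` A).
Proof.
move=> [p cp pS] [D cD ->].
pose g (z : T * baire) := ((p (slice 0 z.2), z.1), slice 1 z.2).
apply: (@analyticP _ _ (g @^-1` D)).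
  apply: closed_preimage cD; rewrite /g.
  apply: pair_continuous; last first.
    by apply: comp_continuous; [exact: snd_continuous|exact: slice_continuous].
  apply: pair_continuous; last exact: fst_continuous.
  apply: (comp_continuous (f := slice 0 \o snd)) => //.
  by apply: comp_continuous; [exact: snd_continuous|exact: slice_continuous].
move=> y; split=> [[_ [[[x y'] s] Ds <-] /= <-]|[s Ds]]; last first.
  by exists (p (slice 0 s), y) => //; exists (g (y, s)).
have [t tx] := pS x.
have [r rE] := slice_surj (fun n => if n is 0%N then t else s).
by exists r; rewrite /= /g /= !rE tx.
Qed.

(** * Polish spaces as continuous images of the Baire space *)

Definition is_metric (R : realType) (T : topologicalType) (d : T -> T -> R) :=
  [/\ forall x y, d x y = 0 <-> x = y,
      forall x y, d x y = d y x,
      forall x y z, d x z <= d x y + d y z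
    & forall (x : T) (U : set T),
        nbhs x U <-> exists2 e : R, 0 < e & [set y | d x y < e] `<=` U].

Section Metric.
Context {R : realType} {T : topologicalType} {d : T -> T -> R}.
Hypothesis metric_d : is_metric d.

Lemma metric_xx x : d x x = 0.
Proof. by have [d0 _ _ _] := metric_d; exact/d0. Qed.

Lemma metric_ge0 x y : 0 <= d x y.
Proof.
have [_ ds dt _] := metric_d.
by have := dt x y x; rewrite metric_xx (ds y x); lra.
Qed.

Lemma metric_gt0 x y : x <> y -> 0 < d x y.
Proof.
have [d0 _ _ _] := metric_d => xy.
by rewrite lt_neqAle metric_ge0 andbT; apply/eqP => /esym/d0.
Qed.

Lemma metric_ball x (e : R) : 0 < e -> nbhs x [set y | d x y < e].
Proof. by have [_ _ _ dn] := metric_d => e0; apply/dn; exists e. Qed.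

Lemma metric_hausdorff_space : hausdorff_space T.
Proof.
have [_ ds dt _] := metric_d => x y clxy; apply: contrapT => /metric_gt0 e0.
have e20 : 0 < d x y / 2 by lra.
have [z [/= xz yz]] := clxy _ _ (metric_ball x e20) (metric_ball y e20).
by have := dt x z y; rewrite (ds z y); lra.
Qed.

(** The closed pieces are the sets of points at distance at least 1/(n+1) of the
    complement. *)
Lemma metric_open_Fsigma (U : set T) : open U ->
  exists2 F : nat -> set T, forall n, closed (F n) & U = \bigcup_n F n.
Proof.
have [_ ds dt dn] := metric_d => oU.
exists (fun n => [set x | forall y, ~ U y -> n.+1%:R^-1 <= d x y]).
  move=> n; rewrite -openC openE => x /= /existsNP[y /not_implyP[Uy]].
  move=> /negP; rewrite -ltNge => xy; rewrite /interior.
  move: (n.+1%:R^-1) xy => q xy; have e0 : 0 < q - d x y by lra.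
  apply: filterS (metric_ball x e0) => z /= xz /(_ y Uy).
  by have := dt z x y; rewrite (ds z x); lra.
apply/seteqP; split=> [x Ux|x [n _ Fx]]; last first.
  apply: contrapT => /Fx; rewrite metric_xx leNgt invr_gt0.
  by rewrite ltr0n.
have /dn[e e0 eU] : nbhs x U by apply: open_nbhs_nbhs.
have [n] := ltr_add_invr e0; rewrite add0r => ne; exists n => // y Uy.
by rewrite leNgt; apply/negP => xy; apply: Uy; apply: eU => /=; exact: lt_trans ne.
Qed.

End Metric.

Lemma is_metricX (R : realType) (S T : topologicalType)
    (d : S -> S -> R) (e : T -> T -> R) :
  is_metric d -> is_metric e ->
  is_metric (fun z w : S * T => d z.1 w.1 + e z.2 w.2).
Proof.
move=> md me; have [d0 ds dt dn] := md; have [e0 es et en] := me.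
split=> [[x y] [x' y']|[x y] [x' y']|[x y] [x' y'] [x2 y2]|[x y] W] /=.
- have d1 := metric_ge0 md x x'; have e1 := metric_ge0 me y y'.
  split=> [de|[-> ->]]; last by rewrite (metric_xx md) (metric_xx me) addr0.
  by congr pair; [apply/d0|apply/e0]; lra.
- by rewrite ds es.
- by have := dt x x' x2; have := et y y' y2; lra.
- split=> [[[U V] /= [/dn[r r0 rU] /en[s s0 sV]] UVW]|[r r0 rW]]; last first.
    have r20 : 0 < r / 2 by lra.
    exists ([set x' | d x x' < r / 2], [set y' | e y y' < r / 2]) => /=.
      by split; [exact: metric_ball md _ _ r20|exact: metric_ball me _ _ r20].
    by move=> [x' y'] /= [xx yy]; apply: rW => /=; lra.
  exists (Num.min r s); first by rewrite lt_min r0.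
  move=> [x' y'] /=; rewrite lt_min => /andP[rr ss]; apply: UVW; split=> /=.
    by apply: rU => /=; have := metric_ge0 me y y'; lra.
  by apply: sV => /=; have := metric_ge0 md x x'; lra.
Qed.

Section PolishBaireImage.
Context {R : realType} {T : topologicalType} {d : T -> T -> R}.
Hypothesis metric_d : is_metric d.
Hypothesis complete_d : forall u : nat -> T,
  (forall e : R, 0 < e -> exists N, forall m n, (N <= m)%N -> (N <= n)%N ->
     d (u m) (u n) < e) ->
  exists x : T, u @ \oo --> x.
Variable e : nat -> T.
Hypothesis dense_e : forall x (r : R), 0 < r -> exists n, d (e n) x < r.

Let r (n : nat) : R := 1 / 2 ^+ n.

Let r_gt0 n : 0 < r n.
Proof. by rewrite divr_gt0 ?exprn_gt0. Qed.

Let rS n : r n = 2 * r n.+1.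
Proof. by rewrite /r exprS; field; rewrite expf_neq0. Qed.

Let r_small (x : R) : 0 < x -> exists n, r n < x.
Proof.
move=> x0; have [N _ NP] := near_infty_natSinv_expn_lt (PosNum x0).
by exists N; apply: NP => /=.
Qed.

(** The sequence [s] proposes the points [e (s n)] one after the other; a
    proposal is ignored when it is too far from the current point.  So every [s]
    defines a Cauchy sequence, which keeps the coding total, and any sufficiently
    fast approximation of a point is followed faithfully. *)
Fixpoint approx (s : baire) (n : nat) : T :=
  if n is m.+1 then
    if d (approx s m) (e (s n)) < r m then e (s n) else approx s m
  else e (s 0%N).

Lemma approx_step s n : d (approx s n) (approx s n.+1) <= r n.
Proof.
rewrite /=; case: ifP => [/ltW//|_].
by rewrite (metric_xx metric_d) ltW.
Qed.

Lemma approx_tail s n m : (n <= m)%N ->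
  d (approx s n) (approx s m) <= 2 * r n - 2 * r m.
Proof.
have [_ _ dt _] := metric_d.
move=> /subnK <-; elim: (m - n)%N => [|k IHk].
  by rewrite add0n (metric_xx metric_d) subrr.
have := dt (approx s n) (approx s (k + n)) (approx s (k + n).+1).
by have := approx_step s (k + n); have := rS (k + n); rewrite addSn; lra.
Qed.

Lemma approx_cvg s : exists x : T, approx s @ \oo --> x.
Proof.
have [_ ds dt _] := metric_d.
apply: complete_d => x x0; have [N Nx] : exists n, r n < x / 4.
  by apply: r_small; lra.
exists N => m n /(approx_tail s) Nm /(approx_tail s) Nn.
have := dt (approx s m) (approx s N) (approx s n).
by rewrite (ds _ (approx s N)); have := r_gt0 m; have := r_gt0 n; lra.
Qed.

(** The limit of [approx s] lies within 2 r(n) of its n-th term, which depends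
    on the first n+1 terms of [s] only: this gives continuity.  A point [x] is
    reached by choosing [e (s n)] within r(n+1) of [x]. *)
Lemma polish_baire_image : baire_image T.
Proof.
have [d0 ds dt dn] := metric_d.
have [p pP] : {p : baire -> T & forall s, approx s @ \oo --> p s}.
  by apply: (@choice _ _ (fun s (x : T) => approx s @ \oo --> x)); exact: approx_cvg.
have pd s n : d (approx s n) (p s) <= 2 * r n.
  apply/ler_addgt0Pr => x x0.
  have [N _ NP] := pP s _ (metric_ball metric_d (p s) x0).
  have /= := NP (maxn N n) (leq_maxl _ _).
  have := approx_tail s (leq_maxr N n); have := r_gt0 (maxn N n).
  have := dt (approx s n) (approx s (maxn N n)) (p s).
  by rewrite (ds (approx s (maxn N n)) (p s)); lra.
exists p.
  move=> s U /dn[x x0 xU]; have [n nx] : exists n, r n < x / 4.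
    by apply: r_small; lra.
  apply: filterS (cyl_nbhs n.+1 s) => t ts; apply: xU => /=.
  have ts_n : approx t n = approx s n.
    elim: n {nx} ts => [|n IHn] ts /=; first by rewrite ts.
    by rewrite IHn ?ts// => k kn; apply: ts; rewrite ltnW.
  have := pd s n; have := pd t n; rewrite ts_n.
  by have := dt (p s) (approx s n) (p t); rewrite (ds (p s) (approx s n)); lra.
move=> x; have [s sP] : {s : baire & forall n, d (e (s n)) x < r n.+1}.
  by apply: (@choice _ _ (fun n k => d (e k) x < r n.+1)) => n; exact: dense_e.
exists s; apply/d0.
have sE n : approx s n = e (s n).
  elim: n => //= n ->; rewrite ifT//.
  have := dt (e (s n)) x (e (s n.+1)); rewrite (ds x).
  have := sP n; have := sP n.+1; have := rS n; have := rS n.+1.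
  by have := r_gt0 n.+2; lra.
apply/eqP; rewrite eq_le metric_ge0// andbT.
apply/ler_addgt0Pr => z z0; have [n nz] : exists n, r n < z / 4.
  by apply: r_small; lra.
have := pd s n; rewrite sE; have := sP n; have := rS n; have := r_gt0 n.
by have := dt (p s) (e (s n)) x; rewrite (ds (p s) (e (s n))); lra.
Qed.

End PolishBaireImage.

Lemma polish_metric_baire (R : realType) (T : topologicalType) :
  polish_space R T -> (exists x : T, True) ->
  (exists d : T -> T -> R, is_metric d) /\ baire_image T.
Proof.
move=> [[D cD dD] [d [d0 ds dt dn complete_d]]] [x0 _].
have md : is_metric d by [].
have dense_pick (x : T) (r : R) : 0 < r -> exists2 y, D y & d y x < r.
  move=> r0; have := nbhs_interior (metric_ball md x r0).
  move=> /nbhs_singleton xr; 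
  have [|y [iy Dy]] := dD _ _ (open_interior [set y | d x y < r]).
    by exists x; exact: xr.
  by exists y => //; rewrite ds; exact: (interior_subset iy).
split; first by exists d.
have /pfcard_geP[D0|[e]] := cD.
  by have [y] := dense_pick x0 1 ltr01; rewrite D0.
apply: (@polish_baire_image _ _ d md complete_d e) => x r /(dense_pick x)[y Dy yx].
by have [n _ ny] := @surj _ _ _ _ e _ Dy; exists n; rewrite ny.
Qed.

(** * Borel sets and Lusin separation *)

Section Borel.
Context {T : topologicalType}.
Implicit Types A B : set T.

Lemma borelC A : borel_set A -> borel_set (~` A).
Proof. by rewrite -setTD => bA; exact: sigma_algebraCD. Qed.

Lemma borel_bigcup (A : nat -> set T) :
  (forall n, borel_set (A n)) -> borel_set (\bigcup_n A n).
Proof. move=> bA; exact: sigma_algebra_bigcup. Qed.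

Lemma borel_bigcap (A : nat -> set T) :
  (forall n, borel_set (A n)) -> borel_set (\bigcap_n A n).
Proof.
move=> bA; rewrite -[X in borel_set X]setCK setC_bigcap.
by apply: borelC; apply: borel_bigcup => n; exact: borelC.
Qed.

Lemma borelI A B : borel_set A -> borel_set B -> borel_set (A `&` B).
Proof.
move=> bA bB; rewrite -bigcap2E; apply: borel_bigcap => -[|[|n]] //=.
by apply: sub_sigma_algebra; exact: openT.
Qed.

Lemma borelD A B : borel_set A -> borel_set B -> borel_set (A `\` B).
Proof. by move=> bA bB; apply: borelI => //; exact: borelC. Qed.

Lemma open_borel A : open A -> borel_set A.
Proof. move=> oA; exact: sub_sigma_algebra. Qed.

Lemma closed_borel A : closed A -> borel_set A.
Proof. by move=> cA; rewrite -[A]setCK; apply: borelC; apply: open_borel; rewrite openC. Qed.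

Lemma borel_ind (Q : set (set T)) :
  (forall A, open A -> Q A) -> (forall A, Q A -> Q (~` A)) ->
  (forall A : nat -> set T, (forall n, Q (A n)) -> Q (\bigcup_n A n)) ->
  forall A, borel_set A -> Q A.
Proof.
move=> Qo QC QU; have sQ : sigma_algebra setT Q.
  by split=> [|A|//]; [apply: Qo; exact: open0 | rewrite setTD; exact: QC].
exact: (smallest_sub sQ Qo).
Qed.

End Borel.

Lemma borel_preimage (S T : topologicalType) (f : S -> T) (A : set T) :
  continuous f -> borel_set A -> borel_set (f @^-1` A).
Proof.
move=> cf; move: A; apply: borel_ind => [A oA|A bA|A bA].
- by apply: open_borel; apply: open_comp oA => x _; exact: cf.
- exact: borelC.
- by rewrite preimage_bigcup; exact: borel_bigcup.
Qed.

(** The sets that are analytic together with their complement form a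
    sigma-algebra, which contains the open sets because these are countable
    unions of closed sets. *)
Lemma borel_analytic (R : realType) (T : topologicalType) (d : T -> T -> R)
  (A : set T) : is_metric d -> borel_set A -> analytic A.
Proof.
move=> md bA; suff [] : analytic A /\ analytic (~` A) by [].
move: A bA; apply: borel_ind => [U oU|B|B bB].
- split; last by apply: closed_analytic; rewrite closedC.
  have [F cF ->] := metric_open_Fsigma md oU.
  by apply: analytic_bigcup => n; exact: closed_analytic.
- by rewrite setCK => -[].
- split; first by apply: analytic_bigcup => n; have [] := bB n.
  by rewrite setC_bigcup; apply: analytic_bigcap => n; have [] := bB n.
Qed.

Lemma borel_image_set_val (T : topologicalType) (A : set T) (B : set A) :
  borel_set A -> borel_set B -> borel_set (set_val @` B).
Proof.
move=> bA; move: B; apply: borel_ind => [B [U oU <-]|B bB|B bB].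
- rewrite (_ : _ @` _ = A `&` U); first by apply: borelI => //; exact: open_borel.
  apply/seteqP; split=> [_ [x Ux <-]|x [Ax Ux]].
    by split=> //; exact: set_valP.
  by exists (SigSub (mem_set Ax)) => //; rewrite /= set_valE.
- rewrite (_ : _ @` _ = A `\` set_val @` B); first exact: borelD.
  apply/seteqP; split=> [_ [x Bx <-]|x [Ax Bx]].
    split; first exact: set_valP.
    by move=> [y By /val_inj yx]; apply: Bx; rewrite -yx.
  exists (SigSub (mem_set Ax)); last by rewrite set_valE.
  by move=> Bs; apply: Bx; exists (SigSub (mem_set Ax)) => //; rewrite set_valE.
- by rewrite image_bigcup; exact: borel_bigcup.
Qed.

(** If [Q 0] failed at [s0], the step would produce finite sequences, each
    extending the previous one and all failing [Q]; their union would be a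
    sequence that meets no bar. *)
Lemma bar_induction (I : Type) (Q : nat -> (nat -> I) -> Prop) :
  (forall n s t, (forall k, (k < n)%N -> t k = s k) -> Q n s -> Q n t) ->
  (forall s, exists n, Q n s) ->
  (forall n s, (forall t, (forall k, (k < n)%N -> t k = s k) -> Q n.+1 t) ->
     Q n s) ->
  forall s, Q 0%N s.
Proof.
move=> Qext Qbar Qstep s0; apply: contrapT => nQ0.
have [f fP] : {f : nat * (nat -> I) -> nat -> I & forall x, ~ Q x.1 x.2 ->
    ~ Q x.1.+1 (f x) /\ forall k, (k < x.1)%N -> f x k = x.2 k}.
  apply: (@choice _ _ (fun x t => ~ Q x.1 x.2 ->
    ~ Q x.1.+1 t /\ forall k, (k < x.1)%N -> t k = x.2 k)) => -[n s] /=.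
  have [Qs|nQ] := pselect (Q n s); first by exists s.
  apply: contrapT => noext; apply: nQ; apply: Qstep => t ts.
  by apply: contrapT => nQt; apply: noext; exists t.
pose fix s_ n := if n is m.+1 then f (m, s_ m) else s0.
have nQs n : ~ Q n (s_ n).
  by elim: n => //= n IHn; exact: (fP (n, s_ n) IHn).1.
have s_mono n m k : (k < n)%N -> (n <= m)%N -> s_ m k = s_ n k.
  move=> kn /subnK <-; elim: (m - n)%N => //= j IHj.
  rewrite (fP (_, _) (nQs _)).2 //=.
  by rewrite (leq_trans kn)// leq_addl.
(* The term [k] of the limit sequence is fixed from stage [k.+1] on. *)
have [n Qn] := Qbar (fun k => s_ k.+1 k).
by apply: (nQs n); apply: Qext Qn => k kn; apply: s_mono.
Qed.

Section Separation.
Context {T : topologicalType}.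
Implicit Types A B : set T.

Definition borel_separated A B :=
  exists C, [/\ borel_set C, A `<=` C & C `&` B = set0].

Lemma borel_separated_bigcup (A B : nat -> set T) :
  (forall i j, borel_separated (A i) (B j)) ->
  borel_separated (\bigcup_i A i) (\bigcup_j B j).
Proof.
move=> sAB; have [C CP] : {C : nat * nat -> set T & forall ij,
    [/\ borel_set (C ij), A ij.1 `<=` C ij & C ij `&` B ij.2 = set0]}.
  apply: (@choice _ _ (fun ij C =>
    [/\ borel_set C, A ij.1 `<=` C & C `&` B ij.2 = set0])) => -[i j].
  exact: sAB.
exists (\bigcup_i \bigcap_j C (i, j)); split.
- by apply: borel_bigcup => i; apply: borel_bigcap => j; have [] := CP (i, j).
- move=> x [i _ Ax]; exists i => // j _; have [_ + _] := CP (i, j).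
  exact.
- rewrite -subset0 => x [[i _ Cx] [j _ Bx]]; have [_ _ <-] := CP (i, j).
  by split=> //; exact: Cx.
Qed.

(** The parameter codes a point of the Baire space above [x] and a witness that
    [x] belongs to [A]. *)
Lemma analytic_baire_param A : baire_image T -> analytic A ->
  exists C (f : baire -> T), [/\ closed C, continuous f & A = f @` C].
Proof.
move=> [p cp pT] [D cD ->].
have cf : continuous (p \o slice 0).
  by apply: comp_continuous => //; exact: slice_continuous.
exists ((fun s => (p (slice 0 s), slice 1 s)) @^-1` D), (p \o slice 0); split=> //.
  apply: closed_preimage cD; apply: pair_continuous => //.
  exact: slice_continuous.
apply/seteqP; split=> [_ [[x s] Ds <-]|_ [s Ds <-]]; last by eexists; first exact: Ds.
have [t tx] := pT x.
have [r rE] := slice_surj (fun n => if n is 0%N then t else s).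
by exists r; rewrite /= !rE tx.
Qed.

(** Parametrize the two sets by closed subsets [C] and [D] of the Baire space and
    argue by bar induction on a sequence of pairs, which describes two points.
    If the first is not in [C] or the second not in [D], some piece is empty;
    otherwise their images are distinct, and by continuity disjoint open sets
    separate the pieces of some level.  The inductive step splits each piece into countably many. *)
Lemma lusin_separation A B : hausdorff_space T -> baire_image T ->
  analytic A -> analytic B -> A `&` B = set0 -> borel_separated A B.
Proof.
move=> hT pT aA aB AB0.
have [C [f [cC cf Af]]] := analytic_baire_param pT aA.
have [D [g [cD cg Bg]]] := analytic_baire_param pT aB.
pose Q n (s : nat -> nat * nat) := borel_separated
  (f @` (C `&` cyl n (fst \o s))) (g @` (D `&` cyl n (snd \o s))).
have cyl0 (h : baire -> T) E s : h @` (E `&` cyl 0 s) = h @` E.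
  by rewrite (_ : cyl 0 s = setT) ?setIT//; apply/seteqP; split.
suff : Q 0%N (fun=> (0%N, 0%N)) by rewrite /Q !cyl0 -Af -Bg.
apply: bar_induction => [n s t st|s|n s Qn].
- rewrite /Q; suff cylE (h : nat * nat -> nat) :
      cyl n (h \o t) = cyl n (h \o s) by rewrite !cylE.
  by apply/seteqP; split=> r rs k kn; rewrite rs//= st.
- have sub0 E (cE : closed E) (u : baire) : ~ E u -> exists n, E `&` cyl n u = set0.
    move=> Eu; have : nbhs u (~` E) by apply: open_nbhs_nbhs; split=> //; rewrite openC.
    by move=> /nbhs_cyl[n nE]; exists n; rewrite -subset0 => t [Et /nE].
  have [Cs|/(sub0 _ cC)[n n0]] := pselect (C (fst \o s)); last first.
    exists n; exists set0; split; [exact: sigma_algebra0| |by rewrite set0I].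
    by rewrite n0 image_set0.
  have [Ds|/(sub0 _ cD)[n n0]] := pselect (D (snd \o s)); last first.
    exists n; exists setT; split=> //; first by apply: open_borel; exact: openT.
    by rewrite n0 image_set0 setI0.
  have fg : f (fst \o s) != g (snd \o s).
    apply/eqP => fg; suff : set0 (f (fst \o s)) by [].
    rewrite -AB0 Af Bg; split; first by exists (fst \o s : baire).
    by rewrite fg; exists (snd \o s : baire).
  move: hT; rewrite open_hausdorff => /(_ _ _ fg)[[U V] /= [/set_mem Uf /set_mem Vg]].
  move=> [oU oV /eqP UV0].
  have /nbhs_cyl[n nU] : nbhs (fst \o s : baire) (f @^-1` U).
    by apply: cf; exact: open_nbhs_nbhs.
  have /nbhs_cyl[m mV] : nbhs (snd \o s : baire) (g @^-1` V).
    by apply: cg; exact: open_nbhs_nbhs.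
  exists (maxn n m); exists U; split; first exact: open_borel.
    move=> _ [t [_ ts] <-]; apply: nU => k kn.
    by apply: ts; rewrite leq_max kn.
  rewrite -subset0 => x [Ux [t [_ ts] tx]]; rewrite -UV0; split; first exact: Ux.
  by rewrite -tx; apply: mV => k kn; apply: ts; rewrite leq_max kn orbT.
- pose upd i j k := if k == n then (i, j) else s k.
  have split_cyl (h : nat * nat -> nat) (v : nat -> nat -> nat * nat)
      (p : baire -> T) E :
      (forall i k, h (v i k) = if k == n then i else h (s k)) ->
      p @` (E `&` cyl n (h \o s)) = \bigcup_i p @` (E `&` cyl n.+1 (h \o v i)).
    move=> hv; rewrite -image_bigcup; congr (_ @` _).
    apply/seteqP; split=> [t [Et ts]|t [i _ [Et tv]]].
      exists (t n) => //; split=> // k; rewrite ltnS leq_eqVlt /= hv.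
      by case: eqP => [->//|_ /ts].
    split=> // k kn; rewrite tv ?ltnS 1?ltnW//= hv.
    by rewrite ltn_eqF.
  rewrite /Q (split_cyl fst (upd^~ 0%N)); last by move=> i k; rewrite /upd; case: ifP.
  rewrite (split_cyl snd (upd 0%N)); last by move=> i k; rewrite /upd; case: ifP.
  apply: borel_separated_bigcup => i j.
  have -> : fst \o upd i 0%N = fst \o upd i j.
    by apply/funext => k; rewrite /upd /=; case: ifP.
  have -> : snd \o upd 0%N j = snd \o upd i j.
    by apply/funext => k; rewrite /upd /=; case: ifP.
  by apply: Qn => k kn; rewrite /upd ltn_eqF.
Qed.

End Separation.

(** * Borel quasi orders containing an analytic quasi order *)

Section Relations.
Local Open Scope relation_scope.
Context {R : realType} {T : topologicalType} {d : T -> T -> R}.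
Hypothesis metric_d : is_metric d.
Hypothesis baireT : baire_image T.
Implicit Types A B S : set (T * T).

Lemma swap_continuous : continuous (fun z : T * T => (z.2, z.1)).
Proof. by apply: pair_continuous; [exact: snd_continuous|exact: fst_continuous]. Qed.

Lemma analytic_converse A : analytic A -> analytic A^-1.
Proof. by move=> aA; apply: (analytic_preimage swap_continuous aA). Qed.

Lemma borel_converse A : borel_set A -> borel_set A^-1.
Proof. by move=> bA; apply: (borel_preimage swap_continuous bA). Qed.

Lemma analytic_relcomp A B : analytic A -> analytic B -> analytic (A \; B).
Proof.
move=> aA aB.
pose f (z : T * (T * T)) := (z.1, z.2.2); pose g (z : T * (T * T)) := (z.2.1, z.1).
have -> : A \; B = snd @` (f @^-1` A `&` g @^-1` B).
  apply/seteqP; split=> [[x z] [y Bxy Ayz]|_ [[y [x z]] [Ayz Bxy] <-]].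
    by exists (y, (x, z)).
  by exists y.
have c1 := @fst_continuous T (T * T)%type; have c2 := @snd_continuous T (T * T)%type.
apply: (analytic_proj baireT); apply: analyticI.
  apply: analytic_preimage aA; apply: (pair_continuous c1).
  exact: (comp_continuous c2 (@snd_continuous T T)).
apply: analytic_preimage aB; apply: pair_continuous c1.
exact: (comp_continuous c2 (@fst_continuous T T)).
Qed.

Lemma borel_rel_analytic A : borel_set A -> analytic A.
Proof. exact: (borel_analytic (is_metricX metric_d metric_d)). Qed.

Lemma rel_separation A B : analytic A -> analytic B -> A `&` B = set0 ->
  borel_separated A B.
Proof.
apply: lusin_separation; last exact: baire_imageX.
exact: (metric_hausdorff_space (is_metricX metric_d metric_d)).
Qed.

(** First [B1] is interpolated between [S] and the pairs (x, y) such that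
    y S z implies x B z for all z, a set containing [S] by transitivity.  Now
    x B1 y and y S z imply x B z, so [B2] can be interpolated between [S] and the
    pairs (y, z) such that x B1 y implies x B z for all x.  Both outer sets are
    complements of analytic sets, and the intersection of [B1], [B2] and [B] has
    its square inside [B]. *)
Lemma borel_transitive_interpolation S B :
  analytic S -> S \; S `<=` S -> borel_set B -> S `<=` B ->
  exists B', [/\ borel_set B', S `<=` B', B' `<=` B & B' \; B' `<=` B].
Proof.
move=> aS trS bB SB.
have [B1 [bB1 SB1 B1S]] : borel_separated S (S^-1 \; ~` B).
  apply: rel_separation => //.
    by apply: analytic_relcomp; [exact: analytic_converse
                                |apply: borel_rel_analytic; exact: borelC].
  rewrite -subset0 => -[x y] [Sxy [z Bxz Szy]]; apply: Bxz; apply: SB.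
  by apply: trS; exists y.
have [B2 [bB2 SB2 B12]] : borel_separated S (~` B \; B1^-1).
  apply: rel_separation => //.
    by apply: analytic_relcomp; apply: borel_rel_analytic;
      [exact: borelC|exact: borel_converse].
  rewrite -subset0 => -[y z] [Syz [x B1xy Bxz]].
  suff : set0 (x, y) by [].
  by rewrite -B1S; split=> //; exists z.
exists (B `&` (B1 `&` B2)); split.
- by apply: borelI => //; exact: borelI.
- by move=> z Sz; split; [exact: SB|split; [exact: SB1|exact: SB2]].
- by move=> z [].
- move=> [x z] [y [_ [B1xy _]] [_ [_ B2yz]]]; apply: contrapT => Bxz.
  suff : set0 (y, z) by [].
  by rewrite -B12; split=> //; exists x.
Qed.

(** Iterate the interpolation and intersect: each term contains the square of
    the next one, hence the square of the intersection. *)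
Lemma borel_transitive_between S B :
  analytic S -> S \; S `<=` S -> borel_set B -> S `<=` B ->
  exists C, [/\ borel_set C, S `<=` C, C `<=` B & C \; C `<=` C].
Proof.
move=> aS trS bB SB.
have [f fP] : {f : set (T * T) -> set (T * T) & forall A,
    borel_set A /\ S `<=` A ->
    [/\ borel_set (f A), S `<=` f A, f A `<=` A & f A \; f A `<=` A]}.
  apply: (@choice _ _ (fun A A' => borel_set A /\ S `<=` A ->
    [/\ borel_set A', S `<=` A', A' `<=` A & A' \; A' `<=` A])) => A.
  have [[bA SA]|nA] := pselect (borel_set A /\ S `<=` A); last by exists set0.
  by have [A' A'P] := borel_transitive_interpolation aS trS bA SA; exists A'.
have itP n : borel_set (iter n f B) /\ S `<=` iter n f B.
  by elim: n => //= n /fP[].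
exists (\bigcap_n iter n f B); split.
- by apply: borel_bigcap => n; have [] := itP n.
- by move=> z Sz n _; apply: (itP n).2.
- by move=> z /(_ 0%N I).
- move=> z [y xy yz] n _; have [_ _ _] := fP _ (itP n); apply.
  by exists y; [exact: (xy n.+1 I)|exact: (yz n.+1 I)].
Qed.

(** By transitivity, it suffices to find a Borel relation containing [S] whose
    symmetric part lies in [E].  Separating [S] from the analytic set of reversed
    pairs of [S] outside [E] gives [B]; then [S] contains no reversed pair of
    [B] outside [E], so these may be removed from [B]. *)
Lemma analytic_quasi_order_borel_extension S (E : set (T * T)) :
  analytic S -> S \; S `<=` S -> borel_set E -> S `&` S^-1 `<=` E ->
  exists C, [/\ borel_set C, S `<=` C, C `&` C^-1 `<=` E & C \; C `<=` C].
Proof.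
move=> aS trS bE SE.
have [B [bB SB BS]] : borel_separated S (S^-1 `\` E).
  apply: rel_separation => //.
    apply: analyticI; first exact: analytic_converse.
    by apply: borel_rel_analytic; exact: borelC.
  by rewrite -subset0 => z [Sz [Sz' Ez]]; apply: Ez; exact: SE.
have bB1 : borel_set (B `\` (B `\` E)^-1).
  by apply: borelD => //; apply: borel_converse; exact: borelD.
have SB1 : S `<=` B `\` (B `\` E)^-1.
  move=> [x y] Sxy; split; first exact: SB.
  move=> [/= Byx Eyx]; suff : set0 (y, x) by [].
  by rewrite -BS; split.
have [C [bC SC CB trC]] := borel_transitive_between aS trS bB1 SB1.
exists C; split=> // -[x y] [/CB[Bxy _] /CB[_ nByx]].
by apply: contrapT => Exy; apply: nByx; split.
Qed.

End Relations.

(** * Realizers and dicolorings *)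

Section Quotient.
Context {P : Type} {le : P -> P -> Prop}.
Hypothesis le_pre : PreOrder le.

Lemma cls_eq x y : cls le x = cls le y <-> qequiv le x y.
Proof.
have [lexx le_trans] := le_pre.
split=> [/(congr1 val) /= xy|[xy yx]].
  by have : qclass le x y by rewrite xy; split; exact: lexx.
apply: val_inj => /=; apply/seteqP; split=> z [].
  by move=> xz zx; split; [exact: le_trans yx xz|exact: le_trans zx xy].
by move=> yz zy; split; [exact: le_trans xy yz|exact: le_trans zy yx].
Qed.

Lemma cls_surj (c : quot le) : exists x, c = cls le x.
Proof. by have [x _ xc] := set_valP c; exists x; apply: val_inj; rewrite /= xc. Qed.

Lemma quot_ltE x y : quot_lt (cls le x) (cls le y) <-> qlt le x y.
Proof.
have [_ le_trans] := le_pre.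
split=> [[x' [y' [/cls_eq[xx' x'x] /cls_eq[yy' y'y] [xy nyx]]]]|xy].
  split; first exact: le_trans (le_trans _ _ _ xx' xy) y'y.
  by move=> yx; apply: nyx; exact: le_trans (le_trans _ _ _ y'y yx) xx'.
by exists x, y.
Qed.

End Quotient.

Lemma not_ge_inhabited (P : topologicalType) (le : P -> P -> Prop)
    (c d : quot le) : PreOrder le -> c <> d -> exists a : not_ge le, True.
Proof.
move=> le_pre; have [x ->] := cls_surj c; have [y ->] := cls_surj d => xy.
have [yx|nyx] := pselect (le y x); last first.
  by exists (SigSub (mem_set (nyx : not_ge le (x, y)))).
have [xy'|nxy] := pselect (le x y); last first.
  by exists (SigSub (mem_set (nxy : not_ge le (y, x)))).
by exfalso; apply: xy; apply/(cls_eq le_pre).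
Qed.

Section Chains.
Local Open Scope relation_scope.
Context {P : Type} (L G : set (P * P)).
Hypothesis trL : L \; L `<=` L.

(** Stage [n] of the quasi order generated by [L] and [G], counting the steps in
    [G]; relations compose from right to left. *)
Fixpoint chain (n : nat) : set (P * P) :=
  if n is m.+1 then chain m \; (G \; L) else L.

Lemma chain_cat m n : chain n \; chain m `<=` chain (m + n).
Proof.
elim: m => [|m IHm] /= [x z] [y].
  case: n => [|n] /= xy; first by move=> yz; apply: trL; exists y.
  move=> [v [u yu uv] vz]; exists v => //; exists u => //.
  by apply: trL; exists y.
move=> [v [u xu uv] vy] yz; exists v; first by exists u.
by apply: IHm; exists y.
Qed.

End Chains.

Section ChainCycle.
Context {P : topologicalType} {le : P -> P -> Prop} (F : set (not_ge le)).
Hypothesis le_pre : PreOrder le.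

Let L : set (P * P) := [set p | le p.1 p.2].
Let G : set (P * P) := set_val @` F.

Lemma chain_path n x y : chain L G n.+1 (x, y) ->
  exists c : nat -> not_ge le, [/\ forall i, (i <= n)%N -> F (c i),
    forall i, (i < n)%N -> not_ge_arc (c i) (c i.+1),
    le x (set_val (c 0%N)).1 & le (set_val (c n)).2 y].
Proof.
elim: n x => [|n IHn] x /= [v [u /= xu [a Fa auv]]] => [vy|/IHn[c [Fc cc vc cy]]].
  by exists (fun=> a); split=> //=; rewrite auv.
exists (fun i => if i is j.+1 then c j else a); split=> //=; last by rewrite auv.
  by case.
by case=> [_|i]; [rewrite /not_ge_arc auv|exact: cc].
Qed.

(** Two opposite chains concatenate to a chain from [x] to itself; if it uses an
    element of [F], these elements form a cycle, the end of the last one being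
    below [x], hence below the start of the first one. *)
Lemma chain_antisym m n x y : ~ has_cycle (not_ge_digraph le) F ->
  chain L G m (x, y) -> chain L G n (y, x) -> le x y /\ le y x.
Proof.
have [_ le_trans] := le_pre.
move=> acyclic xy yx.
have trL : (L \; L `<=` L)%relation.
  by move=> [x1 z1] [y1 /= xy1 yz1]; exact: le_trans xy1 yz1.
have : chain L G (m + n) (x, x) by apply: chain_cat => //; exists y.
(* The chain has a step in [F] unless [m = n = 0]. *)
case E: (m + n)%N => [|k].
  by move: E xy yx => /eqP; rewrite addn_eq0 => /andP[/eqP-> /eqP->].
move=> /chain_path[c [Fc cc xc cx]]; exfalso; apply: acyclic.
by exists k, c; split=> //; exact: le_trans cx xc.
Qed.

End ChainCycle.

Section Extension.
Context {R : realType} {P : topologicalType} {d : P -> P -> R}.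
Context {le : P -> P -> Prop}.
Hypothesis metric_d : is_metric d.
Hypothesis baireP : baire_image P.
Hypothesis borel_le : borel_quasi_order le.

Lemma borel_not_ge : borel_set (not_ge le).
Proof.
have [_ bL] := borel_le.
by apply: (borelC (borel_preimage (@swap_continuous P) bL)).
Qed.

(** The quasi order generated by [le] and [F] has the classes of [le] by
    acyclicity and extends to a Borel one with the same classes.  A pair of [F]
    is then strictly increasing, as it is not equivalent for [le]. *)
Lemma acyclic_extension (F : set (not_ge le)) :
  borel_set F -> ~ has_cycle (not_ge_digraph le) F ->
  exists ple : P -> P -> Prop,
    [/\ borel_quasi_order ple, forall x y, le x y -> ple x y,
        forall x y, qequiv ple x y <-> qequiv le x y
      & forall a : not_ge le, F a -> qlt ple (set_val a).1 (set_val a).2].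
Proof.
move=> bF acyclic; have [le_pre bL] := borel_le.
have [lexx le_trans] := le_pre.
pose L := [set p | le p.1 p.2]; pose G : set (P * P) := set_val @` F.
have aL : analytic L := borel_rel_analytic metric_d bL.
have aG : analytic G.
  by apply: (borel_rel_analytic metric_d); exact: borel_image_set_val borel_not_ge bF.
pose S := \bigcup_n chain L G n.
have aS : analytic S.
  apply: analytic_bigcup; elim=> //= n IHn.
  exact: (analytic_relcomp baireP IHn (analytic_relcomp baireP aG aL)).
have trL : (L \; L `<=` L)%relation by move=> [x z] [y /= xy yz]; exact: le_trans xy yz.
have trS : (S \; S `<=` S)%relation.
  move=> [x z] [y [m _ xy] [n _ yz]]; exists (m + n)%N => //.
  by apply: chain_cat => //; exists y.
have [C [bC SC CE trC]] : exists C, [/\ borel_set C, S `<=` C,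
    (C `&` C^-1)%relation `<=` (L `&` L^-1)%relation & (C \; C `<=` C)%relation].
  apply: (analytic_quasi_order_borel_extension metric_d baireP) => //.
    by apply: borelI => //; exact: borel_converse.
  move=> [x y] [[m _ xy] [n _ yx]].
  exact: (chain_antisym le_pre acyclic xy yx).
have leC x y : le x y -> C (x, y) by move=> xy; apply: SC; exists 0%N.
exists (fun x y => C (x, y)); split=> // [|x y|a Fa].
- split; last by rewrite (_ : [set _ | _] = C)//; apply/seteqP; split=> -[].
  split=> [x|x y z xy yz]; first exact: leC.
  by apply: trC; exists y.
- split=> [[xy yx]|[xy yx]]; last by split; exact: leC.
  by have [] := CE (x, y) (conj xy yx).
- have Ca : C ((set_val a).1, (set_val a).2).
    apply: SC; exists 1%N => //=; exists (set_val a).2; last exact: lexx.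
    by exists (set_val a).1; [exact: lexx|exists a => //; case: (set_val a)].
  split=> // Ca'; apply: (set_valP a).
  by have [_] := CE ((set_val a).1, (set_val a).2) (conj Ca Ca').
Qed.

End Extension.

Section Equivalence.
Context {P : topologicalType} {le : P -> P -> Prop}.
Hypothesis borel_le : borel_quasi_order le.

(** The colour [i] is given to the pairs whose first point is strictly below the
    second in the i-th order; covering the pair (x, y) uses the realizer at
    (y, x). *)
Lemma realizer_dicoloring (K : Type) :
  borel_realizer le K -> borel_dicoloring (not_ge_digraph le) K.
Proof.
have [le_pre _] := borel_le; move=> [lt [blt ltE cover]].
exists (fun i => [set a | lt i (cls le (set_val a).1) (cls le (set_val a).2)]).
split=> [i||i [k [c [Fc cc ck]]]].
- have [_ [ple [[_ bple] _ ltP]]] := blt i.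
  pose B := [set p : P * P | ple p.1 p.2] `\` [set p | ple p.2 p.1].
  rewrite (_ : [set _ | _] = set_val @^-1` B).
    apply: borel_preimage; first exact: initial_continuous.
    by apply: borelD => //; exact: (borel_preimage (@swap_continuous P) bple).
  by apply/seteqP; split=> a /ltP.
- apply/seteqP; split=> // a _.
  have [i] := cover (set_val a).2 (set_val a).1.
  case=> [lti|/(quot_ltE le_pre)[yx _]|/(cls_eq le_pre)[yx _]].
  + by exists i.
  + by have := set_valP a.
  + by have := set_valP a.
- have [[irr tr] _] := blt i.
  have le_lt x y z : le x y -> lt i (cls le y) (cls le z) -> lt i (cls le x) (cls le z).
    move=> xy yz; have [yx|nyx] := pselect (le y x).
      by rewrite (_ : cls le x = cls le y)//; apply/(cls_eq le_pre).
    by apply: tr yz; apply: ltE; apply/(quot_ltE le_pre).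
  have lt0 j : (j <= k)%N ->
      lt i (cls le (set_val (c 0%N)).1) (cls le (set_val (c j)).2).
    elim: j => [|j IHj] jk; first exact: (Fc 0%N).
    apply: tr (IHj (ltnW jk)) _; apply: le_lt (cc j jk) _; exact: Fc.
  apply: (irr (cls le (set_val (c k)).2)).
  by apply: le_lt ck _; exact: lt0.
Qed.

(** Each colour class is made increasing by a Borel extension of [le], and any
    pair that fails [le] has a colour.  A pair in the order is realized by any
    index whatsoever; such an index exists as [not_ge le] is inhabited. *)
Lemma dicoloring_realizer (R : realType) (d : P -> P -> R) (K : Type) :
  is_metric d -> baire_image P -> (exists a : not_ge le, True) ->
  borel_dicoloring (not_ge_digraph le) K -> borel_realizer le K.
Proof.
move=> md baireP [a0 _] [F [bF coverF acyclic]]; have [le_pre _] := borel_le.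
have [ple pleP] : {ple : K -> P -> P -> Prop & forall i,
    [/\ borel_quasi_order (ple i), forall x y, le x y -> ple i x y,
        forall x y, qequiv (ple i) x y <-> qequiv le x y
      & forall a : not_ge le, F i a -> qlt (ple i) (set_val a).1 (set_val a).2]}.
  apply: (@choice _ _ (fun i ple =>
    [/\ borel_quasi_order ple, forall x y, le x y -> ple x y,
        forall x y, qequiv ple x y <-> qequiv le x y
      & forall a : not_ge le, F i a -> qlt ple (set_val a).1 (set_val a).2])) => i.
  exact: (acyclic_extension md baireP borel_le (bF i) (acyclic i)).
pose lt i (c d : quot le) :=
  exists x y, [/\ c = cls le x, d = cls le y & qlt (ple i) x y].
have ltP i x y : lt i (cls le x) (cls le y) <-> qlt (ple i) x y.
  have [[[_ ple_trans] _] le_ple _ _] := pleP i.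
  split=> [[x' [y' [/(cls_eq le_pre)[/le_ple xx' /le_ple x'x]]]]|]; last by exists x, y.
  move=> /(cls_eq le_pre)[/le_ple yy' /le_ple y'y] [xy nyx].
  split; first exact: ple_trans (ple_trans _ _ _ xx' xy) y'y.
  by move=> yx; apply: nyx; exact: ple_trans (ple_trans _ _ _ y'y yx) xx'.
exists lt; split=> [i|i c c' [x [y [-> -> [xy nyx]]]]|x y].
- have [[[ple_refl ple_trans] bple] le_ple pleE _] := pleP i.
  split; last by exists (ple i); split=> //; exact: ltP.
  split=> [c|c1 c2 c3].
    by have [x ->] := cls_surj c; move=> /ltP[].
  have [x ->] := cls_surj c1; have [y ->] := cls_surj c2.
  have [z ->] := cls_surj c3 => /ltP[xy nyx] /ltP[yz nzy]; apply/ltP; split.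
    exact: ple_trans xy yz.
  by move=> zx; apply: nyx; exact: ple_trans yz zx.
- apply/ltP; have [_ le_ple pleE _] := pleP i; split; first exact: le_ple.
  by move=> yx; have /pleE[_] : qequiv (ple i) x y by split=> //; exact: le_ple.
- have [xy|nxy] := pselect (le x y); last first.
    pose a : not_ge le := SigSub (mem_set (nxy : not_ge le (y, x))).
    have [i _ Fa] : (\bigcup_i F i) a by rewrite coverF.
    exists i; apply: Or31; apply/ltP.
    by have [_ _ _ /(_ a Fa)] := pleP i; rewrite /a set_valE.
  have [i _ _] : (\bigcup_i F i) a0 by rewrite coverF.
  exists i; have [yx|nyx] := pselect (le y x).
    by apply: Or33; apply/(cls_eq le_pre).
  by apply: Or32; apply/(quot_ltE le_pre).
Qed.

Lemma dicoloring_bij (J K : Type) (f : J -> K) (g : K -> J) :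
  cancel f g -> cancel g f ->
  borel_dicoloring (not_ge_digraph le) J -> borel_dicoloring (not_ge_digraph le) K.
Proof.
move=> fg gf [F [bF coverF acyclic]]; exists (F \o g); split=> //=.
apply/seteqP; split=> // a _.
have [j _ Fa] : (\bigcup_i F i) a by rewrite coverF.
by exists (f j) => //=; rewrite fg.
Qed.

Lemma singleton_dicoloring : hausdorff_space (P * P)%type ->
  borel_dicoloring (not_ge_digraph le) (not_ge le).
Proof.
move=> hP; exists (fun a => [set a]); split=> [a||a [k [c [ca _ ck]]]].
- rewrite (_ : [set a] = set_val @^-1` [set set_val a]).
    apply: borel_preimage; first exact: initial_continuous.
    by apply: closed_borel; apply: accessible_closed_set1; exact: hausdorff_accessible.
  by apply/seteqP; split=> b /= => [->//|/val_inj].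
- by apply/seteqP; split=> // a _; exists a.
- move: ck; rewrite (ca k)// (ca 0%N)//; exact: not_ge_arc_irrefl.
Qed.

End Equivalence.

Theorem theorem2p30 (R : realType) (P : topologicalType) (le : P -> P -> Prop)
    (polishP : polish_space R P) (borel_le : borel_quasi_order le)
    (card_quot : exists c d : quot le, c <> d) :
  exists K : Type,
    is_odimB le K /\ is_weak_borel_dichromatic (not_ge_digraph le) K.
Proof.
have [le_pre _] := borel_le; have [c [c' cc']] := card_quot.
have inh := not_ge_inhabited le_pre cc'.
have [[d md] baireP] : (exists d : P -> P -> R, is_metric d) /\ baire_image P.
  by apply: polish_metric_baire => //; have [x _] := cls_surj c; exists x.
have realizerE K : borel_realizer le K <-> borel_dicoloring (not_ge_digraph le) K.
  by split; [exact: realizer_dicoloring|exact: dicoloring_realizer md baireP inh].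
have [K [colK minK]] := min_cardinal_exists (@dicoloring_bij P le)
  (singleton_dicoloring (metric_hausdorff_space (is_metricX md md))).
exists K; split; first by split=> [|J /realizerE]; [exact/realizerE|exact: minK].
by split.
Qed.
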